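(* Let $\{\Lambda_t\}_{t\ge0}$ be a dynamical map on $M_d(\mathbb{C})$ with every $\Lambda_t$ invertible, and set $V_{t,s}:=\Lambda_t\Lambda_s^{-1}$ for $t\ge s\ge0$. The following are equivalent: (1) $\{\Lambda_t\}$ is divisible, i.e. $V_{t,s}$ is completely positive for all $t\ge s\ge0$; (2) $\|V_{t,s}\|_\diamond=1$ for all $t\ge s\ge 0$; (3) for every Hermitian $W\in M_d(\mathbb{C})\otimes M_d(\mathbb{C})$, the function $t\mapsto\|(\mathrm{id}\otimes\Lambda_t)W\|_1$ is nonincreasing on $[0,\infty)$.
   Context: A dynamical map is a family $\{\Lambda_t\}_{t\ge0}$ of completely positive trace-preserving linear maps on $M_d(\mathbb{C})$ with $\Lambda_0=\mathrm{id}$. $\|\cdot\|_1$ is the trace norm. For a linear map $\Lambda$ on $M_d(\mathbb{C})$, the diamond norm is $\|\Lambda\|_\diamond:=\sup\{\|(\mathrm{id}\otimes\Lambda)W\|_1: W\in M_d(\mathbb{C})\otimes M_d(\mathbb{C}),\ \|W\|_1=1\}$, where $\mathrm{id}$ is the identity map on $M_d(\mathbb{C})$. *)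

(* Defs.v *)
From Stdlib Require Import Reals.
From HB Require Import structures.
From mathcomp Require Import all_boot all_order all_algebra.
Set Implicit Arguments. Unset Strict Implicit. Unset Printing Implicit Defensive.
Import Order.TTheory GRing.Theory Num.Theory.
Local Open Scope ring_scope.

Section Defs.
Variable C : numClosedFieldType.

Definition adjmx m n (A : 'M[C]_(m, n)) : 'M[C]_(n, m) := (map_mx Num.conj A)^T.

Definition psd n (A : 'M[C]_n) : Prop :=
  forall x : 'cV[C]_n, 0 <= (adjmx x *m A *m x) 0 0.

Definition is_hermitian n (A : 'M[C]_n) : Prop := adjmx A = A.

(* eigenvalues with multiplicity (C algebraically closed) *)
Definition eigenvalues n (A : 'M[C]_n) : seq C :=
  sval (closed_field_poly_normal (char_poly A)).

(* trace norm: sum of singular values = sum of sqrt of eigenvalues of A^* A *)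
Definition trnorm n (A : 'M[C]_n) : C :=
  \sum_(z <- eigenvalues (adjmx A *m A)) sqrtC z.

(* bipartite indices: 'I_(n*m) ~ 'I_n * 'I_m, consistent with mxvec_index *)
Definition idx_pair n m (p : 'I_(n * m)) : 'I_n * 'I_m :=
  enum_val (cast_ord (esym (mxvec_cast n m)) p).

Definition blockmx n m (X : 'M[C]_(n * m)) (i j : 'I_n) : 'M[C]_m :=
  \matrix_(k, l) X (mxvec_index i k) (mxvec_index j l).

(* (id_n (x) f) X *)
Definition ampl n m (f : 'M[C]_m -> 'M[C]_m) (X : 'M[C]_(n * m)) : 'M[C]_(n * m) :=
  \matrix_(p, q) f (blockmx X (idx_pair p).1 (idx_pair q).1) (idx_pair p).2 (idx_pair q).2.

Definition positive_map m (f : 'M[C]_m -> 'M[C]_m) : Prop :=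
  forall X : 'M[C]_m, psd X -> psd (f X).

Definition completely_positive m (f : 'M[C]_m -> 'M[C]_m) : Prop :=
  forall n (X : 'M[C]_(n * m)), psd X -> psd (ampl f X).

Definition trace_preserving m (f : 'M[C]_m -> 'M[C]_m) : Prop :=
  forall X : 'M[C]_m, \tr (f X) = \tr X.

Definition cptp m (f : 'M[C]_m -> 'M[C]_m) : Prop :=
  linear f /\ completely_positive f /\ trace_preserving f.

Definition dynamical_map d (L : R -> 'M[C]_d -> 'M[C]_d) : Prop :=
  (forall t : R, Rle 0 t -> cptp (L t)) /\ (forall X, L R0 X = X).

Definition diamond_norm_is d (f : 'M[C]_d -> 'M[C]_d) (r : C) : Prop :=
  (forall W : 'M[C]_(d * d), trnorm W = 1 -> trnorm (ampl f W) <= r) /\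
  (forall r' : C, (forall W : 'M[C]_(d * d), trnorm W = 1 -> trnorm (ampl f W) <= r') ->
     r <= r').

End Defs.

(* Main.v *)
Require Import Defs.
From Stdlib Require Import Reals.
From HB Require Import structures.
From mathcomp Require Import all_boot all_order all_algebra ring.
Import Order.TTheory GRing.Theory Num.Theory.
Local Open Scope ring_scope.

(** The trace norm of A = U P (polar decomposition) is tr P, so trnorm A <= tr A forces
    tr ((U - 1) P (U - 1)^* ) = 0, hence A = P: a matrix whose trace norm does not exceed
    its trace is positive. A trace-preserving map f for which 1 (x) f does not increase the
    trace norm of the maximally entangled state therefore has a positive Choi matrix, and
    f is completely positive by Choi's theorem. For (3), this is applied to W, the preimage
    of the maximally entangled state under 1 (x) L_s, which is Hermitian because L_s
    preserves adjoints. Conversely, Kraus operators show that a completely positive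
    trace-preserving map contracts the trace norm of all, also non-Hermitian, matrices. *)

(** * Adjoints and positive semidefinite matrices *)

Section PositiveMatrices.
Set Implicit Arguments.
Unset Strict Implicit.
Variable C : numClosedFieldType.

Lemma adjmxK m n (A : 'M[C]_(m, n)) : adjmx (adjmx A) = A.
Proof. by apply/matrixP=> i j; rewrite !mxE conjCK. Qed.

Lemma adjmxM m n p (A : 'M[C]_(m, n)) (B : 'M[C]_(n, p)) :
  adjmx (A *m B) = adjmx B *m adjmx A.
Proof. by rewrite /adjmx map_mxM trmx_mul. Qed.

Lemma adjmxD m n (A B : 'M[C]_(m, n)) : adjmx (A + B) = adjmx A + adjmx B.
Proof. by apply/matrixP=> i j; rewrite !mxE rmorphD. Qed.

Lemma adjmxB m n (A B : 'M[C]_(m, n)) : adjmx (A - B) = adjmx A - adjmx B.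
Proof. by apply/matrixP=> i j; rewrite !mxE rmorphB. Qed.

Lemma adjmx1 n : adjmx (1%:M : 'M[C]_n) = 1%:M.
Proof. by apply/matrixP=> i j; rewrite !mxE rmorphMn rmorph1 eq_sym. Qed.

Lemma adjmx_sum m n (I : finType) (F : I -> 'M[C]_(m, n)) :
  adjmx (\sum_i F i) = \sum_i adjmx (F i).
Proof.
apply/matrixP=> i j; rewrite !mxE !summxE rmorph_sum; apply: eq_bigr => a _.
by rewrite !mxE.
Qed.

Lemma adjmx_diag n (D : 'rV[C]_n) :
  (forall i, 0 <= D 0 i) -> adjmx (diag_mx D) = diag_mx D.
Proof.
move=> D0; apply/matrixP=> i j; rewrite !mxE rmorphMn /= eq_sym.
by case: eqP => [->|//]; rewrite !mulr1n geC0_conj.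
Qed.

Lemma mxtrace_adj n (A : 'M[C]_n) : \tr (adjmx A) = (\tr A)^*.
Proof. by rewrite /mxtrace rmorph_sum; apply: eq_bigr => i _; rewrite !mxE. Qed.

Lemma form_mxE n (A : 'M[C]_n) (x y : 'cV[C]_n) :
  (adjmx x *m A *m y) 0 0 = \sum_i \sum_j (x i 0)^* * A i j * y j 0.
Proof.
rewrite exchange_big /= mxE; apply: eq_bigr => j _; rewrite mxE mulr_suml.
by apply: eq_bigr => i _; rewrite !mxE.
Qed.

Lemma psd_congr m n (A : 'M[C]_n) (X : 'M[C]_(m, n)) :
  psd A -> psd (X *m A *m adjmx X).
Proof. by move=> pA x; have := pA (adjmx X *m x); rewrite adjmxM adjmxK !mulmxA. Qed.

Lemma psd_sum n (I : finType) (F : I -> 'M[C]_n) :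
  (forall i, psd (F i)) -> psd (\sum_i F i).
Proof.
by move=> pF x; rewrite mulmx_sumr mulmx_suml summxE sumr_ge0 // => i _; exact: pF.
Qed.

Lemma psd_diag n (D : 'rV[C]_n) : (forall i, 0 <= D 0 i) -> psd (diag_mx D).
Proof.
move=> D0 x; rewrite form_mxE sumr_ge0 // => i _; rewrite sumr_ge0 // => j _.
rewrite mxE; case: eqP => [<-|_]; last by rewrite mulr0n mulr0 mul0r.
by rewrite mulr1n mulrAC mulr_ge0 // mulrC mul_conjC_ge0.
Qed.

Lemma psd1 n : psd (1%:M : 'M[C]_n).
Proof. by rewrite -diag_const_mx; apply: psd_diag => i; rewrite mxE ler01. Qed.

Lemma psd_gram m n (S : 'M[C]_(m, n)) : psd (S *m adjmx S).
Proof. by rewrite -[S in S *m _]mulmx1; apply/psd_congr/psd1. Qed.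

Lemma psdZ n (c : C) (A : 'M[C]_n) : 0 <= c -> psd A -> psd (c *: A).
Proof. by move=> c0 pA x; rewrite -scalemxAr -scalemxAl mxE mulr_ge0 //; exact: pA. Qed.

Lemma psd_diag_ge0 n (A : 'M[C]_n) i : psd A -> 0 <= A i i.
Proof.
move/(_ (delta_mx i 0)); rewrite form_mxE (bigD1 i) //= (bigD1 i) //=.
rewrite !mxE !eqxx rmorph1 mul1r mulr1 !big1 ?addr0 // => j /negbTE ji.
  by rewrite big1 // => k _; rewrite mxE ji conjC0 !mul0r.
by rewrite mxE ji mulr0.
Qed.

Lemma psd_tr_ge0 n (A : 'M[C]_n) : psd A -> 0 <= \tr A.
Proof. by move=> pA; apply: sumr_ge0 => i _; exact: psd_diag_ge0. Qed.

(** Polarization: the sesquilinear form [q] of [adjmx A - A] vanishes on the diagonal because the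
    form of [A] takes real values. Expanding [q] at [x + c *: y] for [c = 1] and [c = 'i] then kills
    it everywhere. *)
Lemma psd_hermitian n (A : 'M[C]_n) : psd A -> is_hermitian A.
Proof.
move=> pA; rewrite /is_hermitian.
have form_adj (x y : 'cV[C]_n) : (adjmx x *m adjmx A *m y) 0 0
    = ((adjmx y *m A *m x) 0 0)^*.
  by rewrite -[x in RHS]adjmxK -[in LHS](adjmxK y) -!adjmxM [LHS]mxE mxE adjmxK mulmxA.
have real_form (x : 'cV[C]_n) : ((adjmx x *m A *m x) 0 0)^* = (adjmx x *m A *m x) 0 0.
  exact: geC0_conj (pA x).
pose q (x y : 'cV[C]_n) := (adjmx x *m (adjmx A - A) *m y) 0 0.
have qE (x y : 'cV_n) : q x y = (adjmx x *m adjmx A *m y) 0 0 - (adjmx x *m A *m y) 0 0.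
  by rewrite /q mulmxBr mulmxBl !mxE.
have q0 x : q x x = 0 by rewrite qE form_adj real_form subrr.
have addE (X Y : 'M[C]_1) : (X + Y) 0 0 = X 0 0 + Y 0 0 by rewrite mxE.
have scaleE c (X : 'M[C]_1) : (c *: X) 0 0 = c * X 0 0 by rewrite mxE.
have qxy x y c : c^* * q y x + c * q x y = 0.
  have -> : c^* * q y x + c * q x y
      = q (x + c *: y) (x + c *: y) - q x x - c^* * (c * q y y).
    rewrite /q adjmxD; move: (adjmx A - A) => M.
    have -> : adjmx (c *: y) = c^* *: adjmx y.
      by apply/matrixP=> i j; rewrite !mxE rmorphM.
    rewrite !mulmxDl !mulmxDr -!scalemxAl -!scalemxAr !addE !scaleE.
    by ring.
  by rewrite !q0 !mulr0 !subr0.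
have qz x y : q x y = 0.
  have := qxy x y 1; rewrite conjC1 !mul1r => /eqP; rewrite addr_eq0 => /eqP yx.
  have := qxy x y 'i; rewrite conjCi yx mulrNN -mulr2n => /eqP.
  by rewrite mulrn_eq0 /= mulf_eq0 (negbTE (neq0Ci _)) /= => /eqP.
apply/eqP; rewrite -subr_eq0; apply/eqP/matrixP => i j.
rewrite [RHS]mxE -(qz (delta_mx i 0) (delta_mx j 0)) /q form_mxE.
rewrite (bigD1 i) //= (bigD1 j) //= [in X in X + _ + _]mxE !eqxx rmorph1 mul1r.
rewrite [delta_mx j 0 j 0]mxE !eqxx mulr1 !big1 ?addr0 // => k /negbTE ki.
  by rewrite big1 // => l _; rewrite [delta_mx _ _ _ _]mxE ki conjC0 !mul0r.
by rewrite [delta_mx j 0 k 0]mxE ki mulr0.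
Qed.

(** * Spectral decomposition, polar decomposition and the trace norm *)

Lemma psd_spectral n (A : 'M[C]_n) : psd A ->
  exists (Q : 'M[C]_n) (D : 'rV[C]_n),
    [/\ Q *m adjmx Q = 1%:M, forall i, 0 <= D 0 i & A = adjmx Q *m diag_mx D *m Q].
Proof.
move=> pA; have Qu := spectral_unitarymx A.
have Anormal : A \is normalmx.
  apply/hermitian_normalmx/is_hermitianmxP.
  by rewrite expr0 scale1r -map_trmx [LHS](esym (psd_hermitian pA)).
have := orthomx_spectralP Anormal; rewrite invmx_unitary //.
set Q := spectralmx A in Qu *; set D := spectral_diag A.
have -> : map_mx Num.conj Q^T = adjmx Q by rewrite /adjmx map_trmx.
have QQ : Q *m adjmx Q = 1%:M.
  by move/unitarymxP: Qu; rewrite /adjmx map_trmx.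
move=> AE; exists Q, D; split=> // i.
(* The entries of [D] are the diagonal entries of [Q *m A *m adjmx Q], which is again positive. *)
have := psd_diag_ge0 i (psd_congr Q pA).
by rewrite {1}AE !mulmxA QQ mul1mx -mulmxA QQ mulmx1 mxE eqxx.
Qed.

Lemma psd_factor n (A : 'M[C]_n) : psd A -> exists S : 'M[C]_n, A = S *m adjmx S.
Proof.
case/psd_spectral => Q [D [_ D0 ->]].
pose s : 'rV[C]_n := \row_i sqrtC (D 0 i).
exists (adjmx Q *m diag_mx s); rewrite adjmxM adjmxK adjmx_diag; last first.
  by move=> i; rewrite mxE sqrtC_ge0.
rewrite !mulmxA -(mulmxA _ (diag_mx s) (diag_mx s)) mulmx_diag.
congr (_ *m diag_mx _ *m _).
by apply/rowP=> i; rewrite !mxE -expr2 sqrtCK.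
Qed.

(** With [P = S *m adjmx S], the trace is the sum of the squared moduli of the entries of [X *m S],
    so it vanishes only if [X *m S] does. *)
Lemma psd_tr_congr_eq0 m n (P : 'M[C]_n) (X : 'M[C]_(m, n)) :
  psd P -> \tr (X *m P *m adjmx X) = 0 -> X *m P = 0.
Proof.
case/psd_factor => S ->; rewrite mulmxA -mulmxA -adjmxM => tr0.
suff -> : X *m S = 0 by rewrite mul0mx.
apply/matrixP=> i j; rewrite [RHS]mxE; move: tr0; set Y := X *m S.
have Y0 k l : 0 <= Y k l * (Y k l)^* by exact: mul_conjC_ge0.
have YE k : (Y *m adjmx Y) k k = \sum_l Y k l * (Y k l)^*.
  by rewrite mxE; apply: eq_bigr => l _; rewrite !mxE.
move/eqP; rewrite psumr_eq0 => [|k _]; last by rewrite YE sumr_ge0.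
move/allP/(_ i (mem_index_enum _)) => /=; rewrite YE psumr_eq0 //.
move/allP/(_ j (mem_index_enum _)) => /=; rewrite mul_conjC_eq0.
by move/eqP.
Qed.

Lemma char_poly_unitary_diag n (Q : 'M[C]_n) (D : 'rV[C]_n) :
  Q *m adjmx Q = 1%:M ->
  char_poly (adjmx Q *m diag_mx D *m Q) = \prod_i ('X - (D 0 i)%:P).
Proof.
move=> QQ; have QQ' := mulmx1C QQ.
transitivity (char_poly (diag_mx D)); last first.
  rewrite char_poly_trig ?diag_mx_is_trig //.
  by apply: eq_bigr => i _; rewrite mxE eqxx.
rewrite /char_poly /char_poly_mx.
have -> : 'X%:M - map_mx polyC (adjmx Q *m diag_mx D *m Q) =
   map_mx polyC (adjmx Q) *m ('X%:M - map_mx polyC (diag_mx D)) *m map_mx polyC Q.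
  rewrite mulmxBr mulmxBl scalar_mxC -[_ *m _ *m map_mx _ Q]mulmxA -!map_mxM QQ'.
  by rewrite map_mx1 mulmx1.
by rewrite !det_mulmx mulrAC -det_mulmx -map_mxM QQ' map_mx1 det1 mul1r.
Qed.

(** [eigenvalues] is some list of roots of the characteristic polynomial. Unique factorization makes
    it a permutation of the entries of [D], so the trace norm can be read off from any unitary
    diagonalization. *)
Lemma trnorm_spectral n (A Q : 'M[C]_n) (D : 'rV[C]_n) :
  Q *m adjmx Q = 1%:M -> adjmx A *m A = adjmx Q *m diag_mx D *m Q ->
  trnorm A = \sum_i sqrtC (D 0 i).
Proof.
move=> QQ AE; rewrite /trnorm /eigenvalues; case: closed_field_poly_normal => r /=.
rewrite (monicP (char_poly_monic _)) scale1r AE char_poly_unitary_diag //.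
rewrite -(big_map (fun i => D 0 i) xpredT (fun z => 'X - z%:P)).
move/prod_XsubC_eq => rE; rewrite -(perm_big _ rE) /=.
by rewrite big_map.
Qed.

(* U is only a partial isometry: it vanishes on the kernel of P. *)
Lemma polar_decomposition n (A : 'M[C]_n) :
  exists U P : 'M[C]_n, 
    [/\ psd P, U *m adjmx U *m U = U, adjmx U *m U *m P = P, A = U *m P
      & trnorm A = \tr P].
Proof.
have pG : psd (adjmx A *m A) by have := psd_gram (adjmx A); rewrite adjmxK.
have [Q [D [QQ D0 AE]]] := psd_spectral pG.
pose s : 'rV[C]_n := \row_i sqrtC (D 0 i).
have s0 i : 0 <= s 0 i by rewrite mxE sqrtC_ge0.
(* Since [0^-1 = 0], the matrix [T] built from [t] is the pseudo-inverse of [P]: it inverts the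
   nonzero singular values and vanishes on the kernel. *)
pose t : 'rV[C]_n := \row_i (s 0 i)^-1.
have t0 i : 0 <= t 0 i by rewrite mxE invr_ge0.
pose P := adjmx Q *m diag_mx s *m Q.
pose T := adjmx Q *m diag_mx t *m Q.
have dM (a b : 'rV[C]_n) : (adjmx Q *m diag_mx a *m Q) *m (adjmx Q *m diag_mx b *m Q)
    = adjmx Q *m diag_mx (\row_i (a 0 i * b 0 i)) *m Q.
  by rewrite -!mulmxA (mulmxA Q) QQ mul1mx (mulmxA (diag_mx a)) mulmx_diag !mulmxA.
have aT : adjmx T = T by rewrite !adjmxM adjmx_diag // adjmxK mulmxA.
exists (A *m T), P; split.
- have := psd_congr (adjmx Q) (psd_diag s0).
  by rewrite adjmxK.
- transitivity (A *m (T *m (T *m (adjmx A *m A *m T)))).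
    by rewrite adjmxM aT !mulmxA.
  rewrite AE /T !dM; congr (_ *m _).
    congr (_ *m diag_mx _ *m _); apply/rowP=> i; rewrite !mxE.
  have [->|nz] := eqVneq (sqrtC (D 0 i)) 0; first by rewrite invr0 !mul0r.
  by rewrite -{3}(sqrtCK (D 0 i)) expr2 mulfK // mulVf // mulr1.
- rewrite adjmxM aT -(mulmxA T) (mulmxA (adjmx A)) AE !dM.
  congr (_ *m diag_mx _ *m _); apply/rowP=> i; rewrite !mxE.
  have [->|nz] := eqVneq (sqrtC (D 0 i)) 0; first by rewrite !mulr0.
  by rewrite -{2}(sqrtCK (D 0 i)) expr2 mulfK // mulVf // mul1r.
- rewrite -mulmxA dM; set E := diag_mx _.
  (* [1%:M - E] projects onto the coordinates where [s] vanishes. It remains to see that [A] kills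
     the kernel of [adjmx A *m A]; this holds because the Gram matrix of the product has trace
     zero. *)
  suff : A *m adjmx Q *m (1%:M - E) = 0.
    rewrite mulmxBr mulmx1 => /eqP; rewrite subr_eq0 => /eqP AQ.
    by rewrite !mulmxA -AQ -mulmxA (mulmx1C QQ) mulmx1.
  have -> : 1%:M - E = diag_mx (\row_i (1 - (s 0 i)^-1 * s 0 i)).
    rewrite -diag_const_mx -linearB; congr diag_mx.
    by apply/rowP=> i; rewrite !mxE.
  rewrite -[LHS]mulmx1; apply: psd_tr_congr_eq0; first exact: psd1.
  rewrite mulmx1 mxtrace_mulC adjmxM adjmxM adjmxK !mulmxA -(mulmxA _ (adjmx A)) AE.
  rewrite !mulmxA -(mulmxA _ Q) QQ mulmx1 -(mulmxA _ Q) QQ mulmx1.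
  have e0 i : 0 <= (\row_i (1 - (s 0 i)^-1 * s 0 i)) 0 i.
    rewrite mxE; have [->|nz] := eqVneq (s 0 i) 0; first by rewrite mulr0 subr0.
    by rewrite mulVf // subrr.
  rewrite adjmx_diag // !mulmx_diag mxtrace_diag big1 // => i _; rewrite !mxE.
  have [s00|nz] := eqVneq (sqrtC (D 0 i)) 0; last by rewrite mulVf // subrr mulr0.
  have -> : D 0 i = 0 by rewrite -(sqrtCK (D 0 i)) s00 expr0n.
  by rewrite mulr0 mul0r.
- rewrite (trnorm_spectral QQ AE) mxtrace_mulC mulmxA QQ mul1mx mxtrace_diag.
  by apply: eq_bigr => i _; rewrite mxE.
Qed.

Lemma trnorm_psd n (A : 'M[C]_n) : psd A -> trnorm A = \tr A.
Proof.
move=> pA; have [Q [D [QQ D0 AE]]] := psd_spectral pA.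
have := psd_hermitian pA; rewrite /is_hermitian => hA.
rewrite (@trnorm_spectral n A Q (\row_i (D 0 i * D 0 i)) QQ).
  rewrite AE mxtrace_mulC mulmxA QQ mul1mx mxtrace_diag.
  by apply: eq_bigr => i _; rewrite mxE -expr2 sqrCK.
rewrite hA AE -!mulmxA (mulmxA Q) QQ mul1mx (mulmxA (diag_mx D)) mulmx_diag.
by rewrite !mulmxA.
Qed.

Lemma psd_of_trnorm_le_tr n (A : 'M[C]_n) : trnorm A <= \tr A -> psd A.
Proof.
have [U [P [pP _ UP -> ->]]] := polar_decomposition A.
have hP := psd_hermitian pP; rewrite /is_hermitian in hP.
move=> le_tr.
(* The hypothesis puts [\tr (U *m P)] above [\tr P], which is nonnegative. It is therefore real and
   equals the trace of the adjoint. *)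
have trUP : \tr (P *m adjmx U) = \tr (U *m P).
  rewrite -{1}hP -adjmxM mxtrace_adj geC0_conj //.
  exact: le_trans (psd_tr_ge0 pP) le_tr.
have trE : \tr ((U - 1%:M) *m P *m adjmx (U - 1%:M)) = (\tr P - \tr (U *m P)) *+ 2.
  rewrite adjmxB adjmx1 mulmxBr mulmx1 mulmxBl mul1mx mulmxBl !linearB /= trUP.
  by rewrite mxtrace_mulC mulmxA UP mulr2n opprB.
(* The trace in [trE] is nonnegative by positivity of [P] and nonpositive by hypothesis. *)
have UP1 : (U - 1%:M) *m P = 0.
  apply: psd_tr_congr_eq0 => //; apply/le_anti.
  rewrite (psd_tr_ge0 (psd_congr _ pP)) andbT trE.
  by rewrite pmulrn_lle0 // subr_le0.
by move/eqP: UP1; rewrite mulmxBl mul1mx subr_eq0 => /eqP ->.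
Qed.

(** * Contraction of the trace norm by Kraus maps *)

(** Expand the nonnegative trace of [(X - Y) *m P *m adjmx (X - Y)]. *)
Lemma psd_tr_cross n m (P : 'M[C]_n) (X Y : 'M[C]_(m, n)) : psd P ->
  \tr (X *m P *m adjmx Y) + \tr (Y *m P *m adjmx X) <=
  \tr (X *m P *m adjmx X) + \tr (Y *m P *m adjmx Y).
Proof.
move=> pP; rewrite -subr_ge0; have := psd_tr_ge0 (psd_congr (X - Y) pP).
rewrite adjmxB !mulmxBl !mulmxBr !linearB /= => h; apply: (le_trans h).
by rewrite le_eqVlt; apply/orP; left; apply/eqP; ring.
Qed.

(** [E = adjmx U *m U] is an orthogonal projection, and the difference of the two traces is the
    trace of the compression of [N] by [1%:M - E]. *)
Lemma psd_tr_partial_isometry n (N U : 'M[C]_n) :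
  psd N -> U *m adjmx U *m U = U -> \tr (U *m N *m adjmx U) <= \tr N.
Proof.
move=> pN UE; pose E := adjmx U *m U.
have EE : E *m E = E by rewrite /E -mulmxA (mulmxA U) UE.
have aE : adjmx E = E by rewrite adjmxM adjmxK.
have FF : (1%:M - E) *m (1%:M - E) = 1%:M - E.
  by rewrite mulmxBr mulmx1 mulmxBl mul1mx EE subrr subr0.
have := psd_tr_ge0 (psd_congr (1%:M - E) pN).
rewrite adjmxB adjmx1 aE mxtrace_mulC mulmxA FF mulmxBl mul1mx linearB /= subr_ge0.
by rewrite -[\tr (U *m N *m _)]mxtrace_mulC mulmxA.
Qed.

(* Write W = U P and F W = U' P'. Then tr P' is the cross term of the G_i U and the
   U' G_i in the form (X, Y) |-> tr (X P Y^* ), so it is at most the mean of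
   tr F (U P U^* ) = tr P and tr (U' (F P) U'^* ) <= tr P. *)
Lemma trnorm_kraus_le n (I : finType) (G : I -> 'M[C]_n) (W : 'M[C]_n) :
  (forall X, \tr (\sum_i G i *m X *m adjmx (G i)) = \tr X) ->
  trnorm (\sum_i G i *m W *m adjmx (G i)) <= trnorm W.
Proof.
pose F X := \sum_i G i *m X *m adjmx (G i).
move=> trF; rewrite -/(F W).
have [U [P [pP _ UP WE ->]]] := polar_decomposition W.
have [U' [P' [pP' U'U' U'P' BE ->]]] := polar_decomposition (F W).
(* By cyclicity the sum is the trace of [adjmx U' *m F W], that is of
   [adjmx U' *m U' *m P' = P']. *)
have crossE : \sum_i \tr (G i *m U *m P *m adjmx (U' *m G i)) = \tr P'.
  rewrite -[in RHS]U'P' -mulmxA -BE mxtrace_mulC /F mulmx_suml linear_sum /=.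
  by apply: eq_bigr => i _; rewrite adjmxM WE !mulmxA.
(* These terms are the complex conjugates of those in [crossE], and [\tr P'] is real. *)
have crossE' : \sum_i \tr (U' *m G i *m P *m adjmx (G i *m U)) = \tr P'.
  rewrite -(geC0_conj (psd_tr_ge0 pP')) -crossE rmorph_sum /=; apply: eq_bigr => i _.
  by rewrite -mxtrace_adj !adjmxM !adjmxK (psd_hermitian pP) !mulmxA.
have le_sum : \tr P' + \tr P' <= \sum_i \tr (G i *m U *m P *m adjmx (G i *m U))
    + \sum_i \tr (U' *m G i *m P *m adjmx (U' *m G i)).
  rewrite -{1}crossE -crossE' -!big_split /=; apply: ler_sum => i _.
  exact: psd_tr_cross.
have X_E : \sum_i \tr (G i *m U *m P *m adjmx (G i *m U)) = \tr P.
  rewrite -[in RHS]UP -mulmxA mxtrace_mulC -trF linear_sum.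
  by apply: eq_bigr => i _; rewrite adjmxM !mulmxA.
have Y_E : \sum_i \tr (U' *m G i *m P *m adjmx (U' *m G i)) <= \tr P.
  rewrite -(trF P); apply: le_trans (psd_tr_partial_isometry _ U'U'); last first.
    by apply: psd_sum => i; exact: psd_congr.
  rewrite mulmx_sumr mulmx_suml linear_sum /= le_eqVlt; apply/orP; left; apply/eqP.
  by apply: eq_bigr => i _; rewrite adjmxM !mulmxA.
rewrite -(@ler_pMn2r _ 2) // !mulr2n; apply: (le_trans le_sum).
by rewrite X_E lerD2l.
Qed.

End PositiveMatrices.

(** * Amplified maps and their blocks *)

Section Amplification.
Set Implicit Arguments.
Unset Strict Implicit.
Variable C : numClosedFieldType.

Lemma idx_pairK n m (i : 'I_n) (k : 'I_m) : idx_pair (mxvec_index i k) = (i, k).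
Proof. by rewrite /idx_pair cast_ordK enum_rankK. Qed.

Lemma amplE n m (f : 'M[C]_m -> 'M[C]_m) (X : 'M[C]_(n * m)) i j k l :
  ampl f X (mxvec_index i k) (mxvec_index j l) = f (blockmx X i j) k l.
Proof. by rewrite mxE !idx_pairK. Qed.

Lemma blockmx_ampl n m (f : 'M[C]_m -> 'M[C]_m) (X : 'M[C]_(n * m)) i j :
  blockmx (ampl f X) i j = f (blockmx X i j).
Proof. by apply/matrixP=> k l; rewrite mxE amplE. Qed.

(** [ampl f] acts on each block separately, so identities between amplifications reduce through this
    lemma to identities for [f]. *)
Lemma blockmx_inj n m (X Y : 'M[C]_(n * m)) :
  (forall i j, blockmx X i j = blockmx Y i j) -> X = Y.
Proof.
move=> XY; apply/matrixP; case/mxvec_indexP=> i k; case/mxvec_indexP=> j l.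
by move/matrixP/(_ k l): (XY i j); rewrite !mxE.
Qed.

Lemma ampl_comp n m (f g : 'M[C]_m -> 'M[C]_m) (X : 'M[C]_(n * m)) :
  ampl (f \o g) X = ampl f (ampl g X).
Proof. by apply: blockmx_inj => i j; rewrite !blockmx_ampl. Qed.

Lemma eq_ampl n m (f g : 'M[C]_m -> 'M[C]_m) (X : 'M[C]_(n * m)) :
  f =1 g -> ampl f X = ampl g X.
Proof. by move=> fg; apply: blockmx_inj => i j; rewrite !blockmx_ampl. Qed.

Lemma ampl_id n m (X : 'M[C]_(n * m)) : ampl id X = X.
Proof. by apply: blockmx_inj => i j; rewrite blockmx_ampl. Qed.

Lemma blockmx_adj n m (X : 'M[C]_(n * m)) i j :
  blockmx (adjmx X) i j = adjmx (blockmx X j i).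
Proof. by apply/matrixP=> k l; rewrite !mxE. Qed.

Lemma ampl_adj n m (f : 'M[C]_m -> 'M[C]_m) (X : 'M[C]_(n * m)) :
  (forall Y, f (adjmx Y) = adjmx (f Y)) -> ampl f (adjmx X) = adjmx (ampl f X).
Proof.
by move=> fA; apply: blockmx_inj => i j; rewrite blockmx_adj !blockmx_ampl blockmx_adj.
Qed.

Lemma amplZ n m (f : 'M[C]_m -> 'M[C]_m) c (X : 'M[C]_(n * m)) :
  scalable f -> ampl f (c *: X) = c *: ampl f X.
Proof.
have blockZ (Y : 'M[C]_(n * m)) i j : blockmx (c *: Y) i j = c *: blockmx Y i j.
  by apply/matrixP=> k l; rewrite !mxE.
by move=> fZ; apply: blockmx_inj => i j; rewrite blockZ !blockmx_ampl blockZ fZ.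
Qed.

Lemma sum_mxvec_index n m (F : 'I_(n * m) -> C) :
  \sum_p F p = \sum_i \sum_k F (mxvec_index i k).
Proof.
rewrite pair_bigA (reindex _ (curry_mxvec_bij n m)) /=.
by apply: eq_bigr => -[i k].
Qed.

Lemma mxtrace_blocks n m (X : 'M[C]_(n * m)) : \tr X = \sum_i \tr (blockmx X i i).
Proof.
rewrite /mxtrace sum_mxvec_index; apply: eq_bigr => i _; apply: eq_bigr => k _.
by rewrite mxE.
Qed.

Lemma mxtrace_ampl n m (f : 'M[C]_m -> 'M[C]_m) (X : 'M[C]_(n * m)) :
  trace_preserving f -> \tr (ampl f X) = \tr X.
Proof.
by move=> trf; rewrite !mxtrace_blocks; apply: eq_bigr => i _; rewrite blockmx_ampl trf.
Qed.

(** * Amplification of Kraus operators *)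

(* 1_n (x) K *)
Definition ampl_op n m (K : 'M[C]_m) : 'M[C]_(n * m) :=
  \matrix_(p, q) (((idx_pair p).1 == (idx_pair q).1)%:R * K (idx_pair p).2 (idx_pair q).2).

Lemma sum_ampl_op n m (K : 'M[C]_m) (F : 'I_(n * m) -> C) i k :
  \sum_p ampl_op n K (mxvec_index i k) p * F p = \sum_a K k a * F (mxvec_index i a).
Proof.
rewrite sum_mxvec_index (bigD1 i) //= [X in _ + X]big1 ?addr0 => [|j /negbTE ji].
  by apply: eq_bigr => a _; rewrite mxE !idx_pairK eqxx mul1r.
by rewrite big1 // => a _; rewrite mxE !idx_pairK eq_sym ji !mul0r.
Qed.

Lemma blockmx_ampl_op n m (K : 'M[C]_m) (X : 'M[C]_(n * m)) i j :
  blockmx (ampl_op n K *m X *m adjmx (ampl_op n K)) i j =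
  K *m blockmx X i j *m adjmx K.
Proof.
have left_op (Y : 'M[C]_(n * m)) i' j' :
    blockmx (ampl_op n K *m Y) i' j' = K *m blockmx Y i' j'.
  apply/matrixP=> k l; rewrite !mxE sum_ampl_op; apply: eq_bigr => a _.
  by rewrite mxE.
(* Multiplication on the right reduces to [left_op] by taking adjoints, which swaps the two block
   indices. *)
rewrite -[LHS]adjmxK -blockmx_adj adjmxM adjmxK left_op adjmxM blockmx_adj adjmxK.
by rewrite left_op.
Qed.

Lemma ampl_kraus n m (I : finType) (K : I -> 'M[C]_m) f (X : 'M[C]_(n * m)) :
  (forall Y, f Y = \sum_a K a *m Y *m adjmx (K a)) ->
  ampl f X = \sum_a ampl_op n (K a) *m X *m adjmx (ampl_op n (K a)).
Proof.
move=> fK; apply: blockmx_inj => i j; rewrite blockmx_ampl fK.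
apply/matrixP=> k l; rewrite [RHS]mxE !summxE; apply: eq_bigr => a _.
by rewrite -blockmx_ampl_op mxE.
Qed.

Lemma kraus_completely_positive m (I : finType) (K : I -> 'M[C]_m) f :
  (forall Y, f Y = \sum_a K a *m Y *m adjmx (K a)) -> completely_positive f.
Proof.
move=> fK n X pX; rewrite (ampl_kraus _ fK).
by apply: psd_sum => a; exact: psd_congr.
Qed.

(** The operators [ampl_op n (K a)] are Kraus operators of the amplified map, which still preserves
    the trace. *)
Lemma kraus_contraction n m (I : finType) (K : I -> 'M[C]_m) f (W : 'M[C]_(n * m)) :
  (forall Y, f Y = \sum_a K a *m Y *m adjmx (K a)) -> trace_preserving f ->
  trnorm (ampl f W) <= trnorm W.
Proof.
move=> fK trf; rewrite (ampl_kraus _ fK); apply: trnorm_kraus_le => X.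
by rewrite -(ampl_kraus _ fK) mxtrace_ampl.
Qed.

Lemma kraus_adj m (I : finType) (K : I -> 'M[C]_m) f :
  (forall Y, f Y = \sum_a K a *m Y *m adjmx (K a)) ->
  forall X, f (adjmx X) = adjmx (f X).
Proof.
move=> fK X; rewrite !fK adjmx_sum; apply: eq_bigr => a _.
by rewrite !adjmxM adjmxK mulmxA.
Qed.

(** * The maximally entangled state and Choi's theorem *)

(** The vector sum of e_i (x) e_i, left unnormalized: the blocks of [max_entangled] are then exactly
    the matrix units, and its trace is [d]. *)
Definition max_entangled_vec d : 'cV[C]_(d * d) :=
  \col_p ((idx_pair p).1 == (idx_pair p).2)%:R.

Definition max_entangled d : 'M[C]_(d * d) :=
  max_entangled_vec d *m adjmx (max_entangled_vec d).

Lemma psd_max_entangled d : psd (max_entangled d).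
Proof. exact: psd_gram. Qed.

Lemma blockmx_max_entangled d i j : blockmx (max_entangled d) i j = delta_mx i j.
Proof.
apply/matrixP=> k l; rewrite !mxE big_ord1 !mxE !idx_pairK /= conjC_nat -natrM mulnb.
by rewrite (eq_sym k) (eq_sym l).
Qed.

Lemma mxtrace_max_entangled d : \tr (max_entangled d) = d%:R.
Proof.
rewrite mxtrace_blocks (eq_bigr (fun=> 1)) ?sumr_const ?card_ord // => i _.
rewrite blockmx_max_entangled /mxtrace (bigD1 i) //= mxE !eqxx big1 ?addr0 // => k.
by rewrite mxE => /negbTE ->.
Qed.

(** The blocks of the Choi matrix are the values of [f] on matrix units. Factoring it as
    [S *m adjmx S] and reshaping each column of [S] into a square matrix gives the Kraus
    operators. *)
Lemma choi_kraus d (f : 'M[C]_d -> 'M[C]_d) :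
  linear f -> psd (ampl f (max_entangled d)) ->
  exists K : 'I_(d * d) -> 'M[C]_d, forall X, f X = \sum_a K a *m X *m adjmx (K a).
Proof.
move=> lin_f /psd_factor [S SE].
pose fL : {linear 'M[C]_d -> 'M[C]_d} := HB.pack f (GRing.isLinear.Build _ _ _ _ f lin_f).
pose K a : 'M[C]_d := \matrix_(k, i) S (mxvec_index i k) a.
have fdelta i j k l : f (delta_mx i j) k l = \sum_a K a k i * (K a l j)^*.
  rewrite -blockmx_max_entangled -amplE SE mxE.
  by apply: eq_bigr => a _; rewrite !mxE.
exists K => X; apply/matrixP=> k l.
have -> : f X = \sum_i \sum_j X i j *: f (delta_mx i j).
  rewrite -[f]/(fL : _ -> _) {1}[X]matrix_sum_delta linear_sum; apply: eq_bigr => i _.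
  by rewrite linear_sum; apply: eq_bigr => j _; rewrite linearZ.
rewrite !summxE.
transitivity (\sum_j \sum_a \sum_i K a k i * X i j * (K a l j)^*).
  under eq_bigr do rewrite summxE; rewrite exchange_big; apply: eq_bigr => j _ /=.
  rewrite exchange_big; apply: eq_bigr => i _ /=; rewrite mxE fdelta mulr_sumr.
  by apply: eq_bigr => a _; rewrite mulrA (mulrC (X i j)).
rewrite exchange_big; apply: eq_bigr => a _ /=; rewrite mxE; apply: eq_bigr => j _.
by rewrite !mxE mulr_suml; apply: eq_bigr => i _; rewrite !mxE.
Qed.

Lemma completely_positive_kraus d (f : 'M[C]_d -> 'M[C]_d) :
  linear f -> completely_positive f ->
  exists K : 'I_(d * d) -> 'M[C]_d, forall X, f X = \sum_a K a *m X *m adjmx (K a).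
Proof.
by move=> lin_f cp; apply: choi_kraus => //; apply: cp; exact: psd_max_entangled.
Qed.

(** Positivity of one matrix, at amplification size [d], yields Kraus operators, and these give
    positivity at every size. *)
Lemma choi_completely_positive d (f : 'M[C]_d -> 'M[C]_d) :
  linear f -> psd (ampl f (max_entangled d)) -> completely_positive f.
Proof.
by move=> lin_f /(choi_kraus lin_f)[K fK]; exact: kraus_completely_positive fK.
Qed.

Lemma cptp_contraction n d (f : 'M[C]_d -> 'M[C]_d) (W : 'M[C]_(n * d)) :
  cptp f -> trnorm (ampl f W) <= trnorm W.
Proof.
case=> lin_f [cp trf]; have [K fK] := completely_positive_kraus lin_f cp.
exact: kraus_contraction fK trf.
Qed.

(** * Complete positivity and the diamond norm *)

(** Contraction gives the upper bound. The normalized maximally entangled state attains it: both the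
    state and its image are positive of trace one. *)
Lemma cptp_diamond_norm d (f : 'M[C]_d -> 'M[C]_d) :
  (0 < d)%N -> cptp f -> diamond_norm_is f 1.
Proof.
move=> d_gt0 cptpf; split=> [W <-|r' le_r']; first exact: cptp_contraction.
have [_ [cp trf]] := cptpf.
pose W : 'M[C]_(d * d) := d%:R^-1 *: max_entangled d.
have pW : psd W by apply: psdZ; [rewrite invr_ge0 ler0n | exact: psd_max_entangled].
have trW : \tr W = 1.
  by rewrite linearZ /= mxtrace_max_entangled mulVf // pnatr_eq0 -lt0n.
have := le_r' W; rewrite trnorm_psd // trW => /(_ erefl).
by rewrite trnorm_psd ?mxtrace_ampl ?trW //; exact: cp.
Qed.

Lemma diamond_norm_completely_positive d (f : 'M[C]_d -> 'M[C]_d) :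
  (0 < d)%N -> linear f -> trace_preserving f -> diamond_norm_is f 1 ->
  completely_positive f.
Proof.
move=> d_gt0 lin_f trf [le1 _]; apply: choi_completely_positive => //.
pose fL : {linear 'M[C]_d -> 'M[C]_d} := HB.pack f (GRing.isLinear.Build _ _ _ _ f lin_f).
have d_neq0 : d%:R != 0 :> C by rewrite pnatr_eq0 -lt0n.
pose W : 'M[C]_(d * d) := d%:R^-1 *: max_entangled d.
have pW : psd W by apply: psdZ; [rewrite invr_ge0 ler0n | exact: psd_max_entangled].
have trW : \tr W = 1 by rewrite linearZ /= mxtrace_max_entangled mulVf.
(* The diamond norm bound concerns matrices of trace norm one, so it is applied to [W]; positivity
   survives multiplication by [d]. *)
have -> : max_entangled d = d%:R *: W by rewrite scalerA divff // scale1r.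
rewrite amplZ; last exact: (linearZZ fL).
apply: psdZ; first exact: ler0n.
by apply: psd_of_trnorm_le_tr; rewrite mxtrace_ampl // trW le1 // trnorm_psd.
Qed.

End Amplification.

(** * Equivalence of the three conditions *)

Theorem theorem3 (C : numClosedFieldType) (d : nat) (hd : (0 < d)%N)
  (L Linv : R -> 'M[C]_d -> 'M[C]_d)
  (HL : dynamical_map L)
  (Hinv : forall t : R, Rle 0 t -> cancel (L t) (Linv t) /\ cancel (Linv t) (L t)) :
  let V := fun t s : R => L t \o Linv s in
  ((forall t s : R, Rle 0 s -> Rle s t -> completely_positive (V t s)) <->
   (forall t s : R, Rle 0 s -> Rle s t -> diamond_norm_is (V t s) 1)) /\
  ((forall t s : R, Rle 0 s -> Rle s t -> diamond_norm_is (V t s) 1) <->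
   (forall W : 'M[C]_(d * d), is_hermitian W ->
      forall t1 t2 : R, Rle 0 t1 -> Rle t1 t2 ->
        trnorm (ampl (L t2) W) <= trnorm (ampl (L t1) W))).
Proof.
move=> V; have [cptpL _] := HL.
have linV t s : Rle 0 s -> Rle s t -> linear (V t s).
  move=> s0 st c X Y; have [LK LinvK] := Hinv s s0.
  have [linLs _] := cptpL s s0; have [linLt _] := cptpL t (Rle_trans _ _ _ s0 st).
  (* [Linv s] inherits linearity from [L s]: the two sides agree after applying the injective map
     [L s]. *)
  rewrite /V /= -linLt; congr (L t _); apply: (can_inj LK).
  by rewrite linLs !LinvK.
have trV t s : Rle 0 s -> Rle s t -> trace_preserving (V t s).
  move=> s0 st X; have [_ LinvK] := Hinv s s0.
  have [_ [_ trLs]] := cptpL s s0.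
  have [_ [_ trLt]] := cptpL t (Rle_trans _ _ _ s0 st).
  by rewrite /V /= trLt -trLs LinvK.
have cp_diamond : (forall t s : R, Rle 0 s -> Rle s t -> completely_positive (V t s)) ->
    forall t s : R, Rle 0 s -> Rle s t -> diamond_norm_is (V t s) 1.
  move=> cpV t s s0 st; apply: cptp_diamond_norm => //.
  by split; [exact: linV | split; [exact: cpV | exact: trV]].
have diamond_cp : (forall t s : R, Rle 0 s -> Rle s t -> diamond_norm_is (V t s) 1) ->
    forall t s : R, Rle 0 s -> Rle s t -> completely_positive (V t s).
  move=> dV t s s0 st; apply: diamond_norm_completely_positive => //.
  - exact: linV.
  - exact: trV.
  - exact: dV.
split; split=> // [dV W _ s t s0 st|decr].
  (* From (2) to (3): [L t] factors as [V t s] after [L s], and [V t s] is a contraction by (1). *)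
  have -> : ampl (L t) W = ampl (V t s) (ampl (L s) W).
    rewrite -ampl_comp; apply: eq_ampl => X.
    by have [LK _] := Hinv s s0; rewrite /V /= LK.
  apply: cptp_contraction.
  by split; [exact: linV | split; [exact: diamond_cp | exact: trV]].
(* From (3) to (2) by way of (1): it suffices that the Choi matrix of [V t s] is positive. *)
apply: cp_diamond => t s s0 st; apply: choi_completely_positive; first exact: linV.
apply: psd_of_trnorm_le_tr; rewrite mxtrace_ampl; last exact: trV.
have pO : psd (max_entangled C d) by exact: psd_max_entangled.
rewrite -trnorm_psd //.
have [LK LinvK] := Hinv s s0; have [linLs [cpLs _]] := cptpL s s0.
have [K LsK] := completely_positive_kraus linLs cpLs.
(* Condition (3) covers Hermitian matrices only. The Kraus form makes [L s] commute with adjoints,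
   and injectivity passes this on to its inverse. *)
have Linv_adj X : Linv s (adjmx X) = adjmx (Linv s X).
  by apply: (can_inj LK); rewrite (kraus_adj LsK) !LinvK.
(* This Hermitian matrix need not be positive. Amplified [L s] sends it to the maximally entangled
   state and amplified [L t] to the Choi matrix of [V t s], so monotonicity compares exactly these
   two trace norms. *)
have := decr (ampl (Linv s) (max_entangled C d)) _ s t s0 st.
rewrite -!ampl_comp (eq_ampl _ (LinvK : L s \o Linv s =1 id)) ampl_id.
by apply; rewrite /is_hermitian -ampl_adj // (psd_hermitian pO).
Qed.
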